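(* Consider a $[pqrs]$ random walk on one of the domains $D=[0,N]$ ($N\ge1$ an integer), $D=[0,\infty)$ or $D=(-\infty,\infty)$. For a starting state $i\in D$ let $v_i$ be the value of the game and $m_i$ the expected time until absorption. Then for all $i\in D$ $$v_i=i+(p-q)\,m_i.$$
   Context: Let $p,q,s>0$, $r\ge0$ with $p+q+r+s=1$. A $[pqrs]$ random walk on an interval $D$ of integers: in each state $n$ that is not an absorbing barrier, at each time unit the walk moves to $n+1$ with probability $p$, moves to $n-1$ with probability $q$, stays in $n$ for a time unit with probability $r$, and with probability $s$ is absorbed in the current state $n$ (the process terminates there). The finite endpoints of $D$ are absorbing barriers: $0$ and $N$ for $[0,N]$, $0$ for $[0,\infty)$, none for $(-\infty,\infty)$; when the walk reaches a barrier it is absorbed there. Each action (step, stay, or absorption in the current non-barrier state) takes one time unit; the time until absorption is the number of time units until the process terminates, and is $0$ when starting in a barrier. The value $v_i$ of the game is the expected value of the final position (the state in which the walk is absorbed) when starting in $i$. *)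

(* Defs.v *)
From HB Require Import structures.
From mathcomp Require Import all_boot all_order all_algebra.
From mathcomp Require Import all_classical all_reals all_analysis.

Set Implicit Arguments.
Unset Strict Implicit.
Unset Printing Implicit Defensive.

Import Order.TTheory GRing.Theory Num.Theory.
Import numFieldNormedType.Exports.

Local Open Scope classical_set_scope.
Local Open Scope ring_scope.

Definition walk_domain (D : interval int) : Prop :=
  [\/ exists2 N : nat, (1 <= N)%N & D = `[0, N%:Z],
      D = `[0, +oo[ | D = `]-oo, +oo[].

Definition barrier (D : interval int) (n : int) : bool :=
  let: Interval a b := D in (a == BLeft n) || (b == BRight n).

(* A state (n, b): the walk is in position n, and b tells whether it has already
   been absorbed there. *)
Definition state : Type := (int * bool)%type.

(* Being in a barrier and being absorbed there are simultaneous, so that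
   entering a barrier costs no time unit beyond the step leading to it. *)
Definition arrive (D : interval int) (n : int) : state := (n, barrier D n).

(* The four target states from (n, false) are pairwise distinct. A state
   (n, false) with n a barrier is never reached, so its row is irrelevant. *)
Definition transition (R : realType) (p q r s : R) (D : interval int)
    (x y : state) : R :=
  let: (n, absorbed) := x in
  if absorbed then (y == x)%:R
  else p * (y == arrive D (n + 1))%:R + q * (y == arrive D (n - 1))%:R
     + r * (y == (n, false))%:R + s * (y == (n, true))%:R.

(* W is a Markov chain with the above transition probabilities, started in i;
   the Markov property is stated in product form, which avoids conditioning on
   events of probability 0. *)
Record pqrs_walk (R : realType) (p q r s : R) (D : interval int) (i : int)
    (d : measure_display) (T : measurableType d) (P : probability T R)
    (W : nat -> T -> state) : Prop := PqrsWalk {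
  walk_measurable : forall t x, measurable [set w | W t w = x];
  walk_start : P [set w | W 0%N w = arrive D i] = 1%E;
  walk_markov : forall (t : nat) (x : nat -> state),
    P [set w | forall k, (k <= t.+1)%N -> W k w = x k] =
    (P [set w | forall k, (k <= t)%N -> W k w = x k] *
     (transition p q r s D (x t) (x t.+1))%:E)%E }.

Definition absorption_time (T : Type) (W : nat -> T -> state) (w : T) :
    option nat :=
  if pselect (exists t, (W t w).2) is left absorbed then Some (ex_minn absorbed)
  else None.

Definition duration (R : realType) (T : Type) (W : nat -> T -> state) (w : T) :
    \bar R :=
  if absorption_time W w is Some t then (t%:R)%:E else +oo%E.

(* The value 0 for a walk that is never absorbed is a dummy: this event has
   probability 0 as s > 0. *)
Definition final_position (R : realType) (T : Type) (W : nat -> T -> state)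
    (w : T) : R :=
  if absorption_time W w is Some t then ((W t w).1)%:~R else 0.

Definition value (R : realType) (d : measure_display) (T : measurableType d)
    (P : probability T R) (W : nat -> T -> state) : \bar R :=
  expectation P (final_position R W).

Definition mean_duration (R : realType) (d : measure_display)
    (T : measurableType d) (P : probability T R) (W : nat -> T -> state) :
    \bar R :=
  (\int[P]_w duration R W w)%E.

(* Main.v *)
Require Import Defs.
From HB Require Import structures.
From mathcomp Require Import all_boot all_order all_algebra.
From mathcomp Require Import all_classical all_reals all_analysis.
From mathcomp Require Import measurable_realfun zify.

Import Order.TTheory GRing.Theory Num.Theory.
Import numFieldNormedType.Exports.

Local Open Scope classical_set_scope.
Local Open Scope ring_scope.

(** Let U and V be the numbers of steps up and down made before absorption.
    The walk ends in i + U - V almost surely, since staying, being absorbed,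
    and resting after absorption leave the position unchanged. The duration is
    the number tau of times t at which the walk is not yet absorbed, and at each
    such time, whatever happened before, it steps up with probability p and down
    with probability q. Summing over t gives E U = p E tau and E V = q E tau,
    hence v_i = i + (p - q) E tau.

    For this computation E tau has to be finite. The same reasoning, applied to
    the event of dying in a non-barrier state, shows that the expected number of
    deaths is s E tau; as a path dies at most once, E tau <= 1 / s. Finiteness of
    E tau also yields absorption with probability 1.

    All these random numbers are instances of [tally e], which counts the times t
    at which the pair (state at t, state at t + 1) satisfies e. Statements about
    individual paths ([displacement], [tally_live], [tally_die_le1]) are
    elementary; they hold for almost all outcomes because a step of transition
    probability 0 almost surely never occurs ([ae_path]). Expectations are sums
    of probabilities by monotone convergence ([integral_tally]), and these
    probabilities come from the one-step law [prob_move].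

    The Markov property is given for complete histories only. Since there are
    countably many histories of a given length, an identity P A = c P B can be
    checked on each history separately ([measure_proportional]); this takes the
    place of conditioning. *)

(** * Random elements with countably many values *)

Section CountableValues.
Set Implicit Arguments.
Unset Strict Implicit.
Context {d : measure_display} {T : measurableType d} {C : countType}.
Variable X : T -> C.
Hypothesis mX : forall c, measurable [set w | X w = c].

Lemma measurable_preimage_countable (A : set C) : measurable (X @^-1` A).
Proof.
have -> : X @^-1` A = \bigcup_c [set w | X w = c /\ A c].
  by apply/seteqP; split=> [w Aw|w [c _ [<-]]] //; exists (X w).
apply: countable_bigcupT_measurable; first exact: countableP.
move=> c; have [Ac|nAc] := pselect (A c).
  by rewrite (_ : mkset _ = [set w | X w = c]) //; apply/seteqP; split=> w //= [].
by rewrite (_ : mkset _ = set0) //; apply/seteqP; split=> w //= [].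
Qed.

Lemma measurable_fun_countable (d' : measure_display) (U : measurableType d')
    (f : C -> U) : measurable_fun [set: T] (f \o X).
Proof.
by move=> _ Y _; rewrite setTI comp_preimage; exact: measurable_preimage_countable.
Qed.

(** The law of total probability, in the one form that is needed: a ratio P A / P B
    that is the same on every fibre of a countably valued X is the global ratio. *)
Lemma measure_proportional (R : realType) (P : {measure set T -> \bar R})
    (A B : set T) (c : R) : measurable A -> measurable B ->
  (forall x, P (A `&` [set w | X w = x]) = c%:E * P (B `&` [set w | X w = x]))%E ->
  P A = (c%:E * P B)%E.
Proof.
move=> mA mB ABc.
(* The fibres of X are listed along nat by their codes; fibres over non-codes
   are empty. *)
pose F n := [set w | pickle (X w) = n].
have mF n : measurable (F n) by exact: (measurable_preimage_countable [set x | pickle x = n]).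
have sumF E : measurable E -> P E = (\sum_(0 <= n <oo) P (E `&` F n))%E.
  move=> mE; rewrite -measure_semi_bigcup; last 3 first.
  - by move=> n; exact: measurableI.
  - by move=> m n _ _ [w [[_ <-] [_ <-]]].
  - by apply: bigcup_measurable => n _; exact: measurableI.
  by congr (P _); apply/seteqP; split=> [w Ew|w [n _ []//]]; exists (pickle (X w)).
rewrite (sumF _ mA) (sumF _ mB) -nneseriesZl => [|n _]; last exact: measure_ge0.
apply: eq_eseriesr => n _; rewrite /F.
case unp: (pickle_inv n : option C) => [x|].
  have -> : [set w | pickle (X w) = n] = [set w | X w = x].
    have xn : pickle x = n by have := @pickle_invK C n; rewrite unp.
    apply/seteqP; split=> w /= h; last by rewrite h.
    by apply: (@pcan_inj _ _ _ _ (@pickleK C)); rewrite h xn.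
  exact: ABc.
suff -> : [set w | pickle (X w) = n] = set0 by rewrite !setI0 measure0 mule0.
by apply/seteqP; split=> w //= h; move: unp; rewrite -h pickleK_inv.
Qed.

End CountableValues.

(** * Deterministic facts about single paths *)

Section Paths.
Set Implicit Arguments.
Unset Strict Implicit.
Variables (R : realType) (D : interval int).
Implicit Types (x : nat -> state) (e : state -> state -> bool).

(** The targets of the four actions, or of resting once absorbed; only these have
    nonzero transition probability. *)
Definition successors (y : state) : seq state :=
  if y.2 then [:: y]
  else [:: arrive D (y.1 + 1); arrive D (y.1 - 1); (y.1, false); (y.1, true)].

(** Written with a target function f, so that stepping up, stepping down and dying
    are instances of one notion to which the one-step law applies uniformly. *)
Definition move (f : state -> state) (y z : state) : bool :=
  ~~ y.2 && (z == f y).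
Definition up := move (fun y => arrive D (y.1 + 1)).
Definition down := move (fun y => arrive D (y.1 - 1)).
Definition die := move (fun y => (y.1, true)).
(** A relation like the moves, so that [tally live] is the time before absorption
    in the same format. *)
Definition live (y z : state) : bool := ~~ y.2.

Lemma transition_eq0 (p q r s : R) (y z : state) :
  z \notin successors y -> transition p q r s D y z = 0.
Proof.
case: y => n [] /=; rewrite /successors /= !inE ?negb_or; first by move/negPf->.
by case/and4P => /negPf-> /negPf-> /negPf-> /negPf->; rewrite !mulr0 !addr0.
Qed.

Definition tally e x : \bar R := (\sum_(0 <= t <oo) (e (x t) (x t.+1))%:R%:E)%E.

Lemma tally_ge0 e x : (0 <= tally e x)%E.
Proof. by apply: nneseries_ge0 => t _ _; rewrite lee_fin ler0n. Qed.

Lemma partial_tally e x n :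
  (\sum_(0 <= t < n) (e (x t) (x t.+1))%:R%:E)%E =
  (\sum_(0 <= t < n) e (x t) (x t.+1))%N%:R%:E :> \bar R.
Proof. by rewrite sumEFin natr_sum. Qed.

Lemma tally_finite e x n : (forall t, (n <= t)%N -> e (x t) (x t.+1) = false) ->
  tally e x = (\sum_(0 <= t < n) e (x t) (x t.+1))%N%:R%:E.
Proof.
move=> e0; rewrite /tally (nneseries_split 0 n) => [|t _]; last by rewrite lee_fin ler0n.
by rewrite add0n partial_tally eseries0 ?adde0 // => t nt _; rewrite e0.
Qed.

Lemma successor_displacement y z : z \in successors y ->
  z.1 = y.1 + ((up y z)%:Z - (down y z)%:Z).
Proof.
case: y => m []; rewrite /successors /up /down /move /= !inE.
  by move=> /eqP->; rewrite subrr addr0.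
have mDneq (k l : int) (b c : bool) : k != l -> ((k, b) == (l, c)) = false.
  by rewrite xpair_eqE => /negPf->.
by case/or4P => /eqP->; rewrite ?eqxx !mDneq //=; lia.
Qed.

Variable x : nat -> state.
Hypothesis x_path : forall t, x t.+1 \in successors (x t).

Lemma absorbed_forever t u : (x t).2 -> (t <= u)%N -> x u = x t.
Proof.
move=> xt; elim: u => [|u IH]; first by rewrite leqn0 => /eqP->.
rewrite leq_eqVlt => /predU1P[<-//|/IH xu].
by have := x_path u; rewrite xu /successors xt inE => /eqP.
Qed.

Lemma displacement n : (x n).1 = (x 0%N).1 +
  ((\sum_(0 <= t < n) up (x t) (x t.+1))%N%:Z -
   (\sum_(0 <= t < n) down (x t) (x t.+1))%N%:Z).
Proof.
elim: n => [|n IH]; first by rewrite !big_geq // addr0.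
rewrite (successor_displacement (x_path n)) IH !big_nat_recr //= !PoszD.
by rewrite -addrA [in RHS]opprD [in RHS]addrACA.
Qed.

(** Absorption is permanent, so after a death no other death can occur. *)
Lemma tally_die_le1 : (tally die x <= 1)%E.
Proof.
(* The bound by the absorption flag, instead of 1, makes the induction go
   through: it says that a path that is still alive has not died before. *)
have le_die n : (\sum_(0 <= t < n) die (x t) (x t.+1) <= (x n).2)%N.
  elim: n => [|n IH]; first by rewrite big_geq.
  rewrite big_nat_recr //=; have := x_path n; rewrite /die /move /successors.
  move: IH; case: (x n) => m [] /= IH; first by rewrite inE => /eqP->; rewrite addn0.
  move: IH; rewrite leqn0 => /eqP-> _; rewrite add0n.
  by case: eqP => // ->.
apply: lime_le; first exact: is_cvg_nneseries.
apply: nearW => n; rewrite partial_tally lee_fin.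
by rewrite -[leRHS]/(1%:R) ler_nat (leq_trans (le_die n)) // leq_b1.
Qed.

Lemma tally_live n : (x n).2 -> (forall k, (k < n)%N -> ~~ (x k).2) ->
  tally live x = n%:R%:E.
Proof.
move=> xn xlt; rewrite (@tally_finite _ _ n) => [|t nt]; last first.
  by rewrite /live (absorbed_forever xn nt) xn.
congr (_%:R%:E); rewrite (eq_big_nat _ _ (F2 := fun=> 1%N)).
  by rewrite sum_nat_const_nat subn0 muln1.
by move=> k /= kn; rewrite /live xlt.
Qed.

Lemma tally_live_pinfty : (forall k, ~~ (x k).2) -> tally live x = +oo%E.
Proof.
move=> xl; apply/eqyP => A A0.
have [n An] : exists n : nat, A <= n%:R.
  by exists (Num.truncn A).+1; rewrite ltW // truncnS_gt.
apply: (@le_trans _ _ n%:R%:E); first by rewrite lee_fin.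
apply: le_trans (nneseries_lim_ge n _) => [|k _ _]; last by rewrite lee_fin ler0n.
rewrite partial_tally lee_fin ler_nat (eq_big_nat _ _ (F2 := fun=> 1%N)).
  by rewrite sum_nat_const_nat subn0 muln1.
by move=> k /= kn; rewrite /live xl.
Qed.

End Paths.

(** * Measurability of the duration and of the final position *)

Section AbsorptionTime.
Set Implicit Arguments.
Unset Strict Implicit.
Context {d : measure_display} {T : measurableType d}.
Variable (W : nat -> T -> state).
Hypothesis mW : forall t x, measurable [set w | W t w = x].

Lemma absorption_timeP w :
  if absorption_time W w is Some t
  then (W t w).2 /\ forall k, (k < t)%N -> ~~ (W k w).2
  else forall k, ~~ (W k w).2.
Proof.
rewrite /absorption_time; case: pselect => [ex|nex].
  case: ex_minnP => t Wt min_t; split=> // k kt.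
  by apply/negP => /min_t; rewrite leqNgt kt.
by move=> k; apply/negP => Wk; apply: nex; exists k.
Qed.

(** Duration and final position are both functions of this countably valued
    random element, so they are measurable as soon as its fibres are. *)
Definition absorption (w : T) : option (nat * state) :=
  omap (fun t => (t, W t w)) (absorption_time W w).

Lemma measurable_absorption a : measurable [set w | absorption w = a].
Proof.
have mWc t (A : set state) : measurable (W t @^-1` A).
  exact: measurable_preimage_countable.
have mlive t : measurable [set w | ~~ (W t w).2] by exact: (mWc t [set y | ~~ y.2]).
case: a => [[t y]|].
  have -> : [set w | absorption w = Some (t, y)] =
      [set w | (W t w).2] `&` \bigcap_(k in `I_t) [set w | ~~ (W k w).2] `&`
      [set w | W t w = y].
    apply/seteqP; split=> w /=; rewrite /absorption; have := absorption_timeP w.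
      case: absorption_time => //= u [Wu Wlt] [<- <-]; split=> //; split=> //.
    case: absorption_time => [u [Wu Wlt]|Wl] /= [[Wt Wltt] <-].
      case: (ltngtP u t) => [ut|tu|-> //].
        by have := Wltt u ut; rewrite /= Wu.
      by have := Wlt t tu; rewrite Wt.
    by have := Wl t; rewrite Wt.
  apply: measurableI => //; apply: measurableI; first exact: (mWc t [set y : state | y.2]).
  exact: fin_bigcap_measurable.
have -> : [set w | absorption w = None] = \bigcap_k [set w | ~~ (W k w).2].
  apply/seteqP; split=> w /=; rewrite /absorption; have := absorption_timeP w.
    by case: absorption_time => //= Wl _ k _; exact: Wl.
  by case: absorption_time => //= u [Wu _] /(_ u I) /=; rewrite Wu.
exact: bigcapT_measurable.
Qed.

Variable R : realType.

Lemma measurable_duration : measurable_fun [set: T] (duration R W).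
Proof.
pose f (a : option (nat * state)) : \bar R := if a is Some (t, _) then t%:R%:E else +oo%E.
have -> : duration R W = f \o absorption; last first.
  exact: measurable_fun_countable measurable_absorption _ _ _.
by apply/funext => w; rewrite /duration /absorption /=; case: absorption_time.
Qed.

Lemma measurable_final_position : measurable_fun [set: T] (final_position R W).
Proof.
pose f (a : option (nat * state)) : R := if a is Some (_, y) then y.1%:~R else 0.
have -> : final_position R W = f \o absorption; last first.
  exact: measurable_fun_countable measurable_absorption _ _ _.
by apply/funext => w; rewrite /final_position /absorption /=; case: absorption_time.
Qed.

End AbsorptionTime.

(** * Transition probabilities and expected counts *)

Section Walk.
Set Implicit Arguments.
Unset Strict Implicit.
Context {R : realType} {p q r s : R} {D : interval int} {i : int}.
Context {d : measure_display} {T : measurableType d} {P : probability T R}.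
Variable W : nat -> T -> state.
Hypothesis hW : pqrs_walk p q r s D i P W.
Implicit Types (e : state -> state -> bool).

Let mW := walk_measurable hW.

Definition history t (w : T) : seq state := mkseq (W ^~ w) t.

Lemma history_eq t w (h : seq state) y0 : size h = t ->
  history t w = h <-> forall k, (k < t)%N -> W k w = nth y0 h k.
Proof.
move=> ht; split=> [<- k kt|hk]; first by rewrite nth_mkseq.
apply: (@eq_from_nth _ y0); first by rewrite size_mkseq.
by move=> k; rewrite size_mkseq => kt; rewrite nth_mkseq // hk.
Qed.

Lemma measurable_history t h : measurable [set w | history t w = h].
Proof.
have [ht|nht] := eqVneq (size h) t; last first.
  rewrite (_ : mkset _ = set0) //; apply/seteqP; split=> w //= wh.
  by move: nht; rewrite -wh size_mkseq eqxx.
rewrite (_ : mkset _ = \bigcap_(k in `I_t) [set w | W k w = nth (0, true) h k]).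
  by apply: fin_bigcap_measurable => // k _; exact: mW.
by apply/seteqP; split=> w; rewrite /= (history_eq w (0, true) ht).
Qed.

Lemma measurable_step t (Q : state -> state -> Prop) :
  measurable [set w | Q (W t w) (W t.+1 w)].
Proof.
pose A := [set h : seq state | Q (nth (0, true) h t) (nth (0, true) h t.+1)].
rewrite (_ : mkset _ = history t.+2 @^-1` A).
  exact: measurable_preimage_countable (measurable_history t.+2) A.
by apply/seteqP; split=> w; rewrite /preimage /A /mkset /history !nth_mkseq /= ?leqnSn.
Qed.

(** Conditioned on any history up to time t that ends in a state satisfying a, the
    step has probability c by the Markov property; c does not depend on the
    history. *)
Lemma prob_move (a : pred state) (f : state -> state) (c : R) t :
  (forall y, a y -> transition p q r s D y (f y) = c) ->
  P [set w | a (W t w) /\ W t.+1 w = f (W t w)] = (c%:E * P [set w | a (W t w)])%E.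
Proof.
move=> ac; apply: (measure_proportional (measurable_history t.+1)).
- exact: measurable_step t (fun y z => a y /\ z = f y).
- exact: measurable_step t (fun y _ => a y).
move=> h; pose y := nth (0, true) h t.
have Wty w : history t.+1 w = h -> W t w = y by rewrite /y => <-; rewrite nth_mkseq.
(* Histories of the wrong length, or whose last state violates a, contribute 0 to
   both sides. *)
have [/andP[/eqP ht ay]|bad] := boolP ((size h == t.+1) && a y); last first.
  have empty (A : set T) : (forall w, A w -> a (W t w)) ->
      A `&` [set w | history t.+1 w = h] = set0.
    move=> Aa; apply/seteqP; split=> w //= [/Aa aW wh]; move: bad.
    by rewrite -(Wty _ wh) aW andbT -wh size_mkseq eqxx.
  by rewrite !empty ?measure0 ?mule0 // => w [].
pose x k := nth (0, true) (rcons h (f y)) k.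
have xle k : (k <= t)%N -> x k = nth (0, true) h k.
  by move=> kt; rewrite /x nth_rcons ht ltnS kt.
have xt1 : x t.+1 = f y by rewrite /x nth_rcons ht ltnn eqxx.
have := walk_markov hW t x.
rewrite {1}(xle t) // -/y xt1 ac // muleC => markov.
transitivity (P [set w | forall k, (k <= t.+1)%N -> W k w = x k]).
  congr (P _); apply/seteqP; split=> w /=.
    move=> [[aW Wt1] wh] k; rewrite leq_eqVlt => /predU1P[->|].
      by rewrite Wt1 (Wty _ wh).
    by rewrite ltnS => kt; rewrite xle // -wh nth_mkseq.
  move=> Wx; have wh : history t.+1 w = h.
    by apply/(history_eq _ (0, true) ht) => k kt; rewrite Wx ?xle // ltnW.
  by rewrite (Wty _ wh) ay Wx // xt1.
rewrite markov; congr (_ * P _)%E; apply/seteqP; split=> w /=.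
  move=> Wx; have wh : history t.+1 w = h.
    by apply/(history_eq _ (0, true) ht) => k kt; rewrite Wx ?xle.
  by rewrite (Wty _ wh).
by move=> [_ wh] k kt; rewrite xle // -wh nth_mkseq.
Qed.

(** Every history of length t + 2 with such a last step has probability 0, and
    there are countably many. *)
Lemma prob_impossible_step t :
  P [set w | transition p q r s D (W t w) (W t.+1 w) = 0] = 0%E.
Proof.
rewrite -(mul0e (P setT)); apply: (measure_proportional (measurable_history t.+2)) => //.
  exact: (measurable_step t (fun y z => transition p q r s D y z = 0)).
move=> h; rewrite mul0e; set A := _ `&` _.
have mA : measurable A.
  apply: measurableI; last exact: measurable_history.
  exact: (measurable_step t (fun y z => transition p q r s D y z = 0)).
pose x k := nth (0, true) h k.
have Wx w k : history t.+2 w = h -> (k <= t.+1)%N -> W k w = x k.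
  by rewrite /x => <- kt; rewrite nth_mkseq.
have [x0|x0] := eqVneq (transition p q r s D (x t) (x t.+1)) 0.
  have := walk_markov hW t x; rewrite x0 mule0; apply: subset_measure0 => //.
    rewrite (_ : mkset _ = \bigcap_(k in `I_t.+2) [set w | W k w = x k]) //.
    by apply: fin_bigcap_measurable => // k _; exact: mW.
  by move=> w [_ wh] k; exact: Wx.
rewrite (_ : A = set0) ?measure0 //; apply/seteqP; split=> w //= [W0 wh].
by move: x0; rewrite -(Wx w) // -(Wx w) // W0 eqxx.
Qed.

Lemma ae_path : {ae P, forall w,
  W 0%N w = arrive D i /\ forall t, W t.+1 w \in successors D (W t w)}.
Proof.
have start : {ae P, forall w, W 0%N w = arrive D i}.
  exists (~` [set w | W 0%N w = arrive D i]); split=> //.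
    by apply: measurableC; exact: mW.
  by rewrite probability_setC ?(walk_start hW) ?subee //; exact: mW.
have steps : {ae P, forall w, forall t, W t.+1 w \in successors D (W t w)}.
  apply: ae_foralln => t.
  exists [set w | transition p q r s D (W t w) (W t.+1 w) = 0]; split.
  - exact: (measurable_step t (fun y z => transition p q r s D y z = 0)).
  - exact: prob_impossible_step.
  - by move=> w /= /negP; exact: transition_eq0.
by apply: filterS2 start steps => w.
Qed.

Lemma step_indic e t w :
  (e (W t w) (W t.+1 w))%:R = \1_[set w | e (W t w) (W t.+1 w)] w :> R.
Proof.
rewrite indicE; case: (boolP (e _ _)) => h; first by rewrite mem_set.
by rewrite memNset //; exact/negP.
Qed.

Lemma measurable_step_indic e t :
  measurable_fun [set: T] (fun w => (e (W t w) (W t.+1 w))%:R%:E : \bar R).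
Proof.
apply/measurable_EFinP; under eq_fun do rewrite step_indic.
by apply: measurable_indic; exact: (measurable_step t e).
Qed.

Lemma measurable_tally e : measurable_fun [set: T] (fun w => tally R e (W ^~ w)).
Proof.
apply: (ge0_emeasurable_sum (P := xpredT)) => [t w _ _|t _].
  by rewrite lee_fin ler0n.
exact: measurable_step_indic.
Qed.

Lemma integral_tally e : (\int[P]_w tally R e (W ^~ w) =
  \sum_(0 <= t <oo) P [set w | e (W t w) (W t.+1 w)])%E.
Proof.
rewrite integral_nneseries //; last by move=> t; exact: measurable_step_indic.
apply: eq_eseriesr => t _; under eq_integral do rewrite step_indic.
by rewrite integral_indic // ?setIT //; exact: (measurable_step t e).
Qed.

Lemma integral_tally_move (f : state -> state) (c : R) :
  (forall n, transition p q r s D (n, false) (f (n, false)) = c) ->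
  (\int[P]_w tally R (move f) (W ^~ w) =
   c%:E * \int[P]_w tally R live (W ^~ w))%E.
Proof.
move=> fc; rewrite !integral_tally -nneseriesZl => [|t _]; last exact: measure_ge0.
apply: eq_eseriesr => t _; rewrite -(prob_move (a := fun y => ~~ y.2) (f := f) (c := c)).
  congr (P _); apply/seteqP; split=> w /=; first by case/andP => ? /eqP.
  by case=> /= h ->; rewrite /move h eqxx.
by case=> n [].
Qed.

End Walk.

(** * The value of the game *)

Lemma integrable_ae_eq (d : measure_display) (T : measurableType d)
    (R : realType) (mu : {measure set T -> \bar R}) (f g : T -> \bar R) :
  measurable_fun [set: T] f -> mu.-integrable [set: T] g ->
  {ae mu, forall w, f w = g w} -> mu.-integrable [set: T] f.
Proof.
move=> mf ig fg; have mg := measurable_int _ ig.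
apply/integrableP; split=> //; have /integrableP[_] := ig; congr (_ < _)%E.
apply: ge0_ae_eq_integral => //; [exact: measurableT_comp|exact: measurableT_comp|].
by apply: filterS fg => w ->.
Qed.

Theorem theorem14 (R : realType) (p q r s : R)
    (p_gt0 : 0 < p) (q_gt0 : 0 < q) (s_gt0 : 0 < s) (r_ge0 : 0 <= r)
    (pqrs1 : p + q + r + s = 1)
    (D : interval int) (hD : walk_domain D) (i : int) (iD : i \in D)
    (d : measure_display) (T : measurableType d) (P : probability T R)
    (W : nat -> T -> state) (hW : pqrs_walk p q r s D i P W) :
  [/\ P.-integrable setT (EFin \o final_position R W),
      P.-integrable setT (duration R W) &
      value P W = ((i%:~R)%:E + (p - q)%:E * mean_duration P W)%E].
Proof.
have mW := walk_measurable hW.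
pose count e (w : T) := tally R e (W ^~ w).
have mcount e : measurable_fun [set: T] (count e) by exact: measurable_tally hW e.
have count0 e w : (0 <= count e w)%E by exact: tally_ge0.
(* The targets of the four actions are distinct, so each row of the transition
   matrix evaluates to a single one of p, q, r, s. *)
have neqD (k l : int) (b c : bool) : k != l -> ((k, b) == (l, c)) = false.
  by rewrite xpair_eqE => /negPf->.
have Eup : (\int[P]_w count (up D) w = p%:E * \int[P]_w count live w)%E.
  apply: (integral_tally_move hW) => n /=.
  by rewrite eqxx !neqD /= ?mulr0 ?mulr1 ?addr0 //; lia.
have Edown : (\int[P]_w count (down D) w = q%:E * \int[P]_w count live w)%E.
  apply: (integral_tally_move hW) => n /=.
  by rewrite eqxx !neqD /= ?mulr0 ?mulr1 ?addr0 ?add0r //; lia.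
have Edie : (\int[P]_w count die w = s%:E * \int[P]_w count live w)%E.
  apply: (integral_tally_move hW) => n /=.
  rewrite eqxx [(n, true) == (n, false)]xpair_eqE andbF.
  by rewrite !neqD /= ?mulr0 ?mulr1 ?add0r //; lia.
have path := ae_path hW.
(* From s E tau = E (number of deaths) <= 1. *)
have Elive : (\int[P]_w count live w < +oo)%E.
  have : (s%:E * \int[P]_w count live w <= 1)%E.
    rewrite -Edie -(probability_setT P) -[leRHS]mul1e -(integral_cst P) //.
    apply: ae_ge0_le_integral => //.
    by apply: filterS path => w [_ Wpath] _; exact: tally_die_le1.
  rewrite ltey; apply: contra_leN => /eqP ->.
  by rewrite gt0_muley ?lte_fin // ltey.
have icount e (c : R) : (\int[P]_w count e w = c%:E * \int[P]_w count live w)%E ->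
    P.-integrable [set: T] (count e).
  move=> Ee; apply/integrableP; split; first exact: mcount.
  under eq_integral do rewrite gee0_abs //.
  rewrite Ee; move: Elive; rewrite -ge0_fin_numE ?integral_ge0 // => /fineK <-.
  by rewrite -EFinM ltey.
have ilive : P.-integrable [set: T] (count live) by apply: (icount _ 1); rewrite mul1e.
have iup := icount _ _ Eup; have idown := icount _ _ Edown.
(* On a path that is never absorbed both sides are infinite. *)
have duration_live : {ae P, forall w, duration R W w = count live w}.
  apply: filterS path => w [_ Wpath]; rewrite /duration.
  have := absorption_timeP W w; case: absorption_time => [t [Wt Wlt]|Wl].
    by rewrite /count (tally_live _ Wpath Wt).
  by rewrite /count tally_live_pinfty.
have iduration : P.-integrable [set: T] (duration R W).
  by apply: integrable_ae_eq ilive duration_live; exact: measurable_duration.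
have istart : P.-integrable [set: T] (EFin \o cst (i%:~R : R)).
  exact: finite_measure_integrable_cst.
(* Almost every path is absorbed because the duration is integrable; on an
   absorbed path the counts are finite sums. *)
have final : {ae P, forall w,
    (final_position R W w)%:E = (i%:~R%:E + (count (up D) w - count (down D) w))%E}.
  apply: filterS3 path duration_live (integrable_ae measurableT ilive).
  move=> w [W0 Wpath] <- /(_ I); rewrite /duration /final_position.
  have := absorption_timeP W w; case: absorption_time => [t [Wt Wlt] _|//].
  have stop f : count (move f) w =
      (\sum_(0 <= k < t) move f (W k w) (W k.+1 w))%N%:R%:E.
    apply: tally_finite => k tk.
    by rewrite /move (absorbed_forever Wpath Wt tk) Wt.
  rewrite [count (up D) w]stop [count (down D) w]stop.
  by rewrite (displacement Wpath t) W0 /= !rmorphD rmorphN /= EFinD EFinB.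
have istep := integrableB measurableT iup idown.
have ifinal : P.-integrable [set: T] (EFin \o final_position R W).
  apply: (integrable_ae_eq _ (integrableD measurableT istart istep) final).
  by apply/measurable_EFinP; exact: measurable_final_position.
have mfinal := measurable_int _ ifinal.
have mstep := measurable_int _ (integrableD measurableT istart istep).
split=> //; rewrite /value unlock /mean_duration.
rewrite (@ae_eq_integral _ _ _ P setT _ _ measurableT mfinal mstep); last first.
  by apply: filterS final => w.
rewrite (integralD measurableT istart istep) (integralB measurableT iup idown).
have -> : (\int[P]_w (EFin \o cst (i%:~R : R)) w = i%:~R%:E)%E.
  by rewrite -(expectation_cst P) unlock.
rewrite Eup Edown.
rewrite (@ae_eq_integral _ _ _ P setT _ _ measurableT (measurable_int _ iduration)
  (measurable_int _ ilive)); last by apply: filterS duration_live => w.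
by rewrite -muleBl // ge0_fin_numE ?integral_ge0.
Qed.
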